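(* Let $\ell\in\mathbb{R}\setminus\{0\}$ and let $\beta\in\mathbb{C}$ satisfy $\beta\neq \ell+i(2k-1)\pi/2$ for all integers $k$. Then for every $s\in\mathbb{C}$, $$\cosh(s-\ell)=\cosh(\beta-\ell)\prod_{k=1}^\infty\left[1+\frac{(s-\ell)^2-(\beta-\ell)^2}{\frac{(2k-1)^2\pi^2}{4}+(\beta-\ell)^2}\right].$$ *)

(* Defs.v *)
From Stdlib Require Import Reals Lra.
From Coquelicot Require Import Coquelicot.

Local Open Scope C_scope.

(** e^(x + i y) = e^x (cos y + i sin y). *)
Definition Cexp (z : C) : C := exp (Re z) * (cos (Im z), sin (Im z)).

Definition Ccosh (z : C) : C := (Cexp z + Cexp (- z)) / 2.

Lemma Cexp_RtoC (x : R) : Cexp x = exp x.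
Proof.
  unfold Cexp; simpl. rewrite cos_0, sin_0.
  apply injective_projections; simpl; ring.
Qed.

Lemma Cexp_plus (z w : C) : Cexp (z + w) = Cexp z * Cexp w.
Proof.
  destruct z as [a b], w as [c d]; unfold Cexp; simpl.
  rewrite exp_plus, cos_plus, sin_plus.
  apply injective_projections; simpl; ring.
Qed.

Lemma Ccosh_RtoC (x : R) : Ccosh x = cosh x.
Proof.
  unfold Ccosh, cosh. rewrite <- RtoC_opp, !Cexp_RtoC, RtoC_div, RtoC_plus by lra.
  reflexivity.
Qed.

(** The product a 1 * ... * a n; the value a 0 is never used. *)
Fixpoint Cprod_upto (a : nat -> C) (n : nat) : C :=
  match n with
  | O => 1
  | S m => Cprod_upto a m * a (S m)
  end.

(** Convergence means convergence of the partial products; the limit may be 0,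
    as it must when some factor vanishes. *)
Definition is_infprod (a : nat -> C) (P : C) : Prop :=
  filterlim (Cprod_upto a) eventually (locally P).

(* Main.v *)
(** For c complex let J_k be the integral of cosh(c t) cos(t)^k over [0, pi/2].
    Two integrations by parts give (n^2 + c^2) J_n = n (n - 1) J_(n-2) for n >= 2, and
    (1 + c^2) J_1 = cosh(c pi/2).  Dividing by W_k, the value of J_k at c = 0, the
    ratios R_k = J_k / W_k satisfy R_(n-2) = (1 + c^2/n^2) R_n, so cosh(c pi/2) is the
    product of 1 + c^2/j^2 over the odd j <= n, times R_n.  Since cosh(c t) - 1 is
    O(sin(t)^2) on [0, pi/2] and sin^2 has moment W_k - W_(k+2) = W_k / (k + 2), R_n
    tends to 1.  The corollary is the quotient of two such factorizations, with
    c = 2 (s - l) / pi and c = 2 (beta - l) / pi. *)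

Require Import Defs.
From Stdlib Require Import Reals Lra Lia.
From Coquelicot Require Import Coquelicot.

(** * Moments against powers of cosine on [0, pi/2] *)

Definition cos_moment (k : nat) (y : R -> R) : R :=
  RInt (fun t => y t * cos t ^ k) 0 (PI / 2).

Lemma continuous_cos_weight (k : nat) (y : R -> R) (t : R) :
  continuous y t -> continuous (fun t => y t * cos t ^ k) t.
Proof.
  intros Hy. apply (continuous_mult (K := R_AbsRing)); [exact Hy|].
  apply (ex_derive_continuous (fun t => cos t ^ k)). now auto_derive.
Qed.

Lemma ex_RInt_cos_weight (k : nat) (y : R -> R) :
  (forall t, continuous y t) ->
  ex_RInt (fun t => y t * cos t ^ k) 0 (PI / 2).
Proof.
  intros Hy. apply (ex_RInt_continuous (V := R_CompleteNormedModule)).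
  intros t _. now apply continuous_cos_weight.
Qed.

(** The combination enters as a separate [h] with a pointwise equation, so it applies to any
    function that agrees with it, whatever its syntactic shape. *)
Lemma cos_moment_lin (k : nat) (p q : R) (f g h : R -> R) :
  (forall t, continuous f t) -> (forall t, continuous g t) ->
  (forall t, h t = p * f t + q * g t) ->
  cos_moment k h = p * cos_moment k f + q * cos_moment k g.
Proof.
  intros Hf Hg Hh.
  apply (is_RInt_unique (V := R_CompleteNormedModule)).
  apply is_RInt_ext with
    (fun t => plus (scal p (f t * cos t ^ k)) (scal q (g t * cos t ^ k))).
  { intros t _. rewrite Hh. unfold plus, scal; simpl; unfold mult; simpl. ring. }
  apply (is_RInt_plus (V := R_NormedModule));
    apply (is_RInt_scal (V := R_NormedModule));
    apply (RInt_correct (V := R_CompleteNormedModule));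
    now apply ex_RInt_cos_weight.
Qed.

Lemma cos_moment_le (k : nat) (f g : R -> R) :
  (forall t, continuous f t) -> (forall t, continuous g t) ->
  (forall t, 0 < t < PI / 2 -> f t <= g t) ->
  cos_moment k f <= cos_moment k g.
Proof.
  intros Hf Hg Hfg. pose proof PI_RGT_0.
  apply RInt_le; [lra | now apply ex_RInt_cos_weight ..|].
  intros t Ht. apply Rmult_le_compat_r; [|now apply Hfg].
  apply pow_le, cos_ge_0; lra.
Qed.

(* Integrate the derivative of n y sin cos^m + y' cos^n, where n = m + 1. *)
Lemma cos_moment_parts (m : nat) (y y' y'' : R -> R) :
  (forall t, is_derive y t (y' t)) -> (forall t, is_derive y' t (y'' t)) ->
  (forall t, continuous y'' t) -> y' 0 = 0 ->
  cos_moment (S m) y'' + INR (S m) ^ 2 * cos_moment (S m) y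
  = INR (S m) * INR m * cos_moment (pred m) y
    + match m with O => y (PI / 2) | S _ => 0 end.
Proof.
  intros Hy Hy' Hc H0.
  assert (Cy : forall t, continuous y t)
    by (intros t; apply (ex_derive_continuous y); eexists; apply Hy).
  set (n := INR (S m)).
  set (F := fun t => n * y t * sin t * cos t ^ m + y' t * cos t ^ S m).
  (* The derivative of [F] once sin^2 is replaced by 1 - cos^2. At m = 0 the exponent [pred m] is a
     default, and the coefficient [INR m] removes the term. *)
  set (dF := fun t => (y'' t * cos t ^ S m + n ^ 2 * (y t * cos t ^ S m))
                      - n * INR m * (y t * cos t ^ pred m)).
  assert (HF : is_RInt dF 0 (PI / 2) (minus (F (PI / 2)) (F 0))).
  { apply (is_RInt_derive (V := R_CompleteNormedModule)).
    - intros t _. unfold F, dF.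
      assert (Ey : Derive y t = y' t) by now apply is_derive_unique.
      assert (Ey' : Derive y' t = y'' t) by now apply is_derive_unique.
      auto_derive.
      + repeat split; eexists; [apply Hy | apply Hy'].
      + change (Derive (fun x => y x) t) with (Derive y t).
        change (Derive (fun x => y' x) t) with (Derive y' t).
        rewrite Ey, Ey'.
        assert (Hs : sin t * sin t = 1 - cos t * cos t)
          by (pose proof (sin2_cos2 t) as E; unfold Rsqr in E; lra).
        replace (match m with O => 1 | S _ => INR m + 1 end) with n
          by (unfold n; destruct m; reflexivity).
        assert (Hn : n = INR m + 1) by apply S_INR.
        assert (Hm : INR m * cos t ^ pred m * (cos t * cos t)
                     = INR m * cos t ^ S m)
          by (destruct m; simpl; ring).
        transitivity (y'' t * cos t ^ S m + n * y t * cos t ^ S m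
          - n * y t * (sin t * sin t) * (INR m * cos t ^ pred m)).
        { simpl; ring. }
        rewrite Hs.
        transitivity (y'' t * cos t ^ S m + n * y t * cos t ^ S m
          - n * y t * (INR m * cos t ^ pred m)
          + n * y t * (INR m * cos t ^ pred m * (cos t * cos t))).
        { ring. }
        rewrite Hm, Hn. ring.
    - intros t _. unfold dF.
      apply (continuous_minus (V := R_NormedModule)
        (fun t => y'' t * cos t ^ S m + n ^ 2 * (y t * cos t ^ S m))).
      + apply (continuous_plus (V := R_NormedModule)).
        * now apply continuous_cos_weight.
        * apply (continuous_scal_r (V := R_NormedModule) (n ^ 2)).
          now apply continuous_cos_weight.
      + apply (continuous_scal_r (V := R_NormedModule) (n * INR m)).
        now apply continuous_cos_weight. }
  assert (HF' : is_RInt dF 0 (PI / 2)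
     (minus (plus (cos_moment (S m) y'') (scal (n ^ 2) (cos_moment (S m) y)))
            (scal (n * INR m) (cos_moment (pred m) y)))).
  { assert (M : forall k f, (forall t, continuous f t) ->
      is_RInt (fun t => f t * cos t ^ k) 0 (PI / 2) (cos_moment k f)).
    { intros k f Hf. apply (RInt_correct (V := R_CompleteNormedModule)).
      now apply ex_RInt_cos_weight. }
    apply (is_RInt_minus (V := R_NormedModule)
      (fun t => y'' t * cos t ^ S m + n ^ 2 * (y t * cos t ^ S m))
      (fun t => n * INR m * (y t * cos t ^ pred m))).
    - apply (is_RInt_plus (V := R_NormedModule)
        (fun t => y'' t * cos t ^ S m) (fun t => n ^ 2 * (y t * cos t ^ S m))).
      + now apply M.
      + apply (is_RInt_scal (V := R_NormedModule)). now apply M.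
    - apply (is_RInt_scal (V := R_NormedModule)). now apply M. }
  assert (E := eq_trans (eq_sym (is_RInt_unique (V := R_CompleteNormedModule) _ _ _ _ HF))
                 (is_RInt_unique (V := R_CompleteNormedModule) _ _ _ _ HF')).
  unfold minus, plus, opp, scal in E; simpl in E; unfold mult in E; simpl in E.
  (* [F 0] vanishes by sin 0 = 0 and y'(0) = 0. At pi/2 what remains is n y(pi/2) 0^m, which is
     y(pi/2) for m = 0, because 0^0 = 1, and 0 otherwise. *)
  unfold F in E. rewrite H0, sin_0, cos_PI2, sin_PI2 in E.
  unfold n in *.
  assert (Z : forall j, 0 ^ S j = 0) by (intros j; simpl; ring).
  destruct m; [simpl in E |- * | rewrite !Z in E]; lra.
Qed.

(** * Wallis integrals and the moment of sin^2 *)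

Definition wallis (k : nat) : R := cos_moment k (fun _ => 1).

Lemma wallis_pos (k : nat) : 0 < wallis k.
Proof.
  pose proof PI_RGT_0.
  apply RInt_gt_0; [lra | |].
  - intros t Ht. rewrite Rmult_1_l. apply pow_lt, cos_gt_0; lra.
  - intros t _. apply continuous_cos_weight, continuous_const.
Qed.

Lemma wallis_rec (m : nat) :
  INR (S m) ^ 2 * wallis (S m)
  = INR (S m) * INR m * wallis (pred m)
    + match m with O => 1 | S _ => 0 end.
Proof.
  pose proof (cos_moment_parts m (fun _ => 1) (fun _ => 0) (fun _ => 0)) as E.
  cbv beta in E. unfold wallis. rewrite <- E.
  - rewrite (cos_moment_lin (S m) 0 0 (fun _ => 1) (fun _ => 1) (fun _ => 0)).
    + ring.
    + intros t; apply continuous_const.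
    + intros t; apply continuous_const.
    + intros t; ring.
  - intros t; apply (is_derive_const (K := R_AbsRing) (V := R_NormedModule) 1).
  - intros t; apply (is_derive_const (K := R_AbsRing) (V := R_NormedModule) 0).
  - intros t; apply continuous_const.
  - reflexivity.
Qed.

(** Write sin^2 = 1 - cos^2 and use (k + 2) W_(k+2) = (k + 1) W_k. The gain 1/(k + 2) over W_k is
    what drives the convergence. *)
Lemma cos_moment_sin2 (k : nat) :
  cos_moment k (fun t => sin t ^ 2) = wallis k / (INR k + 2).
Proof.
  assert (H : cos_moment k (fun t => sin t ^ 2) = wallis k - wallis (S (S k))).
  { assert (Hs : forall t, continuous (fun t => sin t ^ 2) t)
      by (intros t; apply (ex_derive_continuous (fun t => sin t ^ 2)); now auto_derive).
    assert (H2 : wallis (S (S k)) = cos_moment k (fun t => cos t ^ 2)).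
    { apply RInt_ext. intros t _. simpl. ring. }
    rewrite H2. unfold wallis.
    rewrite (cos_moment_lin k 1 (-1) (fun _ => 1) (fun t => sin t ^ 2) (fun t => cos t ^ 2)).
    - ring.
    - intros t; apply continuous_const.
    - exact Hs.
    - intros t. pose proof (sin2_cos2 t) as E. unfold Rsqr in E. simpl. lra. }
  rewrite H. pose proof (wallis_rec (S k)) as R. simpl pred in R.
  pose proof (pos_INR k). rewrite !S_INR in R.
  assert (R' : (INR k + 2) * wallis (S (S k)) = (INR k + 1) * wallis k).
  { apply Rmult_eq_reg_l with (INR k + 2); lra. }
  apply Rmult_eq_reg_l with (INR k + 2); [|lra]. field_simplify; lra.
Qed.

Lemma cos_moment_bound (k : nat) (K : R) (f : R -> R) :
  (forall t, continuous f t) ->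
  (forall t, 0 < t < PI / 2 -> Rabs (f t) <= K * sin t ^ 2) ->
  Rabs (cos_moment k f) <= K * (wallis k / (INR k + 2)).
Proof.
  intros Hf Hb.
  assert (Hs : forall t, continuous (fun t => sin t ^ 2) t)
    by (intros t; apply (ex_derive_continuous (fun t => sin t ^ 2)); now auto_derive).
  assert (E : forall q, cos_moment k (fun t => q * sin t ^ 2)
                       = q * (wallis k / (INR k + 2))).
  { intros q. rewrite (cos_moment_lin k q 0 (fun t => sin t ^ 2) (fun t => sin t ^ 2)); auto.
    - rewrite cos_moment_sin2; ring.
    - intros t; ring. }
  assert (Hc : forall q t, continuous (fun t => q * sin t ^ 2) t).
  { intros q t. apply (ex_derive_continuous (fun t => q * sin t ^ 2)); now auto_derive. }
  apply Rabs_le. split.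
  - rewrite Ropp_mult_distr_l, <- E. apply cos_moment_le; auto.
    intros t Ht. specialize (Hb t Ht). apply Rabs_le_between in Hb. lra.
  - rewrite <- E. apply cos_moment_le; auto.
    intros t Ht. specialize (Hb t Ht). apply Rabs_le_between in Hb. lra.
Qed.

(** * Bounding cosh(c t) - 1 by a multiple of sin(t)^2 *)

Lemma Rabs_sin_le (x : R) : Rabs (sin x) <= Rabs x.
Proof.
  assert (H : forall y, 0 < y -> Rabs (sin y) <= y).
  { intros y Hy. pose proof (sin_lt_x y Hy). pose proof (SIN_bound y).
    apply Rabs_le. split; [|lra].
    destruct (Rle_dec y PI) as [h|h]; [pose proof (sin_ge_0 y); lra|].
    pose proof PI2_1. lra. }
  destruct (Rtotal_order x 0) as [h|[->|h]].
  - rewrite <- Rabs_Ropp, <- sin_neg, (Rabs_left x h). apply H; lra.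
  - rewrite sin_0; lra.
  - rewrite (Rabs_pos_eq x) by lra. auto.
Qed.

(** For y >= 0, sinh y = e^y (1 - e^(-2y)) / 2, and 1 - e^(-2y) <= 2y. Oddness covers negative
    arguments. *)
Lemma Rabs_sinh_le (x : R) : Rabs (sinh x) <= Rabs x * exp (Rabs x).
Proof.
  assert (H : forall y, 0 <= y -> Rabs (sinh y) <= y * exp y).
  { intros y Hy. unfold sinh. pose proof (exp_pos y).
    assert (E : exp (- y) = exp y * exp (- (2 * y)))
      by (rewrite <- exp_plus; f_equal; ring).
    pose proof (exp_ineq1_le (- (2 * y))).
    assert (exp (- y) <= exp y).
    { destruct Hy as [Hy| <-]; [left; apply exp_increasing; lra | rewrite Ropp_0; lra]. }
    rewrite Rabs_pos_eq by lra. rewrite E. nra. }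
  destruct (Rle_dec 0 x) as [h|h].
  - rewrite (Rabs_pos_eq x) by lra. auto.
  - rewrite (Rabs_left x) by lra. rewrite <- (Rabs_Ropp (sinh x)).
    replace (- sinh x) with (sinh (- x)); [apply H; lra|].
    unfold sinh. rewrite Ropp_involutive. field.
Qed.

(** Since pi <= 4, t is at most 2, so sin t >= t - t^3/6 >= t/3. *)
Lemma le_3_sin (t : R) : 0 <= t <= PI / 2 -> t <= 3 * sin t.
Proof.
  intros Ht. pose proof PI_4.
  assert (H' : sin_approx t 1 <= sin t)
    by (apply (pre_sin_bound t 0); lra).
  unfold sin_approx, sin_term in H'. simpl in H'. nra.
Qed.

Lemma cosh_sub_1 (x : R) : cosh x - 1 = 2 * sinh (x / 2) ^ 2.
Proof.
  unfold cosh, sinh.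
  assert (E : forall y, exp y = exp (y / 2) * exp (y / 2))
    by (intros y; rewrite <- exp_plus; f_equal; field).
  assert (I : exp (x / 2) * exp (- (x / 2)) = 1)
    by (rewrite <- exp_plus, Rplus_opp_r; apply exp_0).
  rewrite (E x), (E (- x)). replace (- x / 2) with (- (x / 2)) by field.
  simpl. nra.
Qed.

(** The real part of cosh(c t) for real t, with [im_cosh] as the imaginary part; the splitting keeps
    all derivatives and integrals real. *)
Definition re_cosh (c : C) (t : R) : R := cosh (Re c * t) * cos (Im c * t).
Definition im_cosh (c : C) (t : R) : R := sinh (Re c * t) * sin (Im c * t).

Lemma Ccosh_parts (z : C) :
  Ccosh z = (cosh (Re z) * cos (Im z), sinh (Re z) * sin (Im z)).
Proof.
  destruct z as [x y]. unfold Ccosh, Cexp, cosh, sinh; simpl.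
  rewrite cos_neg, sin_neg.
  apply injective_projections; simpl; field.
Qed.

Lemma Ccosh_re_im (c : C) (t : R) : Ccosh (c * t) = (re_cosh c t, im_cosh c t).
Proof.
  rewrite Ccosh_parts. destruct c as [a b]. unfold re_cosh, im_cosh. simpl.
  replace (a * t - b * 0) with (a * t) by ring.
  replace (a * 0 + b * t) with (b * t) by ring. reflexivity.
Qed.

Lemma re_cosh_continuous (c : C) (t : R) : continuous (re_cosh c) t.
Proof. apply (ex_derive_continuous (re_cosh c)). unfold re_cosh. now auto_derive. Qed.

Lemma im_cosh_continuous (c : C) (t : R) : continuous (im_cosh c) t.
Proof. apply (ex_derive_continuous (im_cosh c)). unfold im_cosh. now auto_derive. Qed.

(** With c = a + i b, the real part minus 1 is (cosh(a t) - 1) cos(b t) - (1 - cos(b t)), and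
    half-angle formulas turn both differences into squares of O(t) terms. The imaginary part is a
    product of two O(t) terms. Finally t <= 3 sin t. *)
Lemma cosh_sub_1_bound (c : C) :
  exists K, 0 <= K /\ forall t, 0 < t < PI / 2 ->
    Rabs (re_cosh c t - 1) <= K * sin t ^ 2 /\ Rabs (im_cosh c t) <= K * sin t ^ 2.
Proof.
  destruct c as [a b]. unfold re_cosh, im_cosh; simpl Re; simpl Im.
  (* Chosen so that |sinh(a t)| <= A t and |sin(b t)| <= B t on the interval; the 2 in the exponent
     bounds pi/2. *)
  set (A := Rabs a * exp (2 * Rabs a)). set (B := Rabs b).
  assert (HA : 0 <= A) by (apply Rmult_le_pos; [apply Rabs_pos | left; apply exp_pos]).
  assert (HB : 0 <= B) by apply Rabs_pos.
  (* The 9 is the square of the constant in [le_3_sin]. *)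
  exists (9 * (A ^ 2 + B ^ 2)). split; [nra|].
  intros t Ht. pose proof PI_4.
  (* The scale r is taken to be 1/2 for the half-angle formulas and 1 for the imaginary part. *)
  assert (Hsh : forall r, 0 <= r <= 1 -> Rabs (sinh (a * t * r)) <= A * t * r).
  { intros r Hr. eapply Rle_trans; [apply Rabs_sinh_le|].
    assert (E : Rabs (a * t * r) = Rabs a * (t * r)).
    { rewrite !Rabs_mult, (Rabs_pos_eq t), (Rabs_pos_eq r) by lra. ring. }
    rewrite E. unfold A. pose proof (Rabs_pos a).
    assert (0 <= t * r) by nra.
    replace (Rabs a * exp (2 * Rabs a) * t * r)
      with (Rabs a * (t * r) * exp (2 * Rabs a)) by ring.
    apply Rmult_le_compat_l; [nra|].
    assert (Rabs a * (t * r) <= 2 * Rabs a) by (assert (t * r <= 2) by nra; nra).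
    destruct (Rle_lt_or_eq_dec (Rabs a * (t * r)) (2 * Rabs a)) as [h|h];
      [assumption | left; now apply exp_increasing | rewrite h; lra]. }
  assert (Hsn : forall r, 0 <= r <= 1 -> Rabs (sin (b * t * r)) <= B * t * r).
  { intros r Hr. eapply Rle_trans; [apply Rabs_sin_le|].
    rewrite !Rabs_mult, (Rabs_pos_eq t), (Rabs_pos_eq r) by lra. unfold B; lra. }
  assert (Hq : (A ^ 2 + B ^ 2) * t ^ 2 <= 9 * (A ^ 2 + B ^ 2) * sin t ^ 2).
  { assert (L := le_3_sin t ltac:(lra)).
    assert (t ^ 2 <= 9 * sin t ^ 2) by nra.
    assert (0 <= A ^ 2 + B ^ 2) by nra. nra. }
  assert (Sq : forall x y, Rabs x <= y -> 0 <= x ^ 2 <= y ^ 2).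
  { intros x y Hxy. apply Rabs_le_between in Hxy. nra. }
  split; (eapply Rle_trans; [|exact Hq]).
  - assert (h1 := Sq _ _ (Hsh (/ 2) ltac:(lra))).
    assert (h2 := Sq _ _ (Hsn (/ 2) ltac:(lra))).
    pose proof (cosh_sub_1 (a * t)) as Ec.
    pose proof (cos_2a_sin (b * t * / 2)) as Es.
    replace (2 * (b * t * / 2)) with (b * t) in Es by field.
    unfold Rdiv in Ec.
    replace (cosh (a * t) * cos (b * t) - 1)
      with ((cosh (a * t) - 1) * cos (b * t) - (1 - cos (b * t))) by ring.
    pose proof (COS_bound (b * t)).
    apply Rabs_le. rewrite Ec.
    set (x := sinh _ ^ 2) in *. set (y := sin (b * t * / 2)) in *.
    assert (1 - cos (b * t) = 2 * y ^ 2) by (rewrite Es; ring).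
    split; nra.
  - assert (h1 := Hsh 1 ltac:(lra)). assert (h2 := Hsn 1 ltac:(lra)).
    rewrite !Rmult_1_r in h1, h2. rewrite Rabs_mult.
    eapply Rle_trans;
      [apply Rmult_le_compat; [apply Rabs_pos | apply Rabs_pos | exact h1 | exact h2]|].
    (* This gives A B t^2 <= (A^2 + B^2) t^2. *)
    assert (0 <= (A - B) ^ 2 * t ^ 2) by (apply Rmult_le_pos; apply pow2_ge_0).
    nra.
Qed.

(** * Complex moments of cosh(c t) *)

Definition cosh_moment (k : nat) (c : C) : C :=
  (cos_moment k (re_cosh c), cos_moment k (im_cosh c)).

(** The function y(t) = cosh(c t) satisfies y'' = c^2 y and y'(0) = 0, so [cos_moment_parts] applies
    to its real and imaginary parts, which c^2 = (a^2 - b^2) + 2 a b i mixes. *)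
Lemma cosh_moment_rec (m : nat) (c : C) :
  ((INR (S m) ^ 2 + c ^ 2) * cosh_moment (S m) c
   = INR (S m) * INR m * cosh_moment (pred m) c
     + match m with O => Ccosh (c * (PI / 2)%R) | S _ => 0 end)%C.
Proof.
  rewrite Ccosh_re_im. unfold cosh_moment.
  destruct c as [a b].
  set (u := re_cosh (a, b)). set (v := im_cosh (a, b)).
  (* Here u' + i v' = c sinh(c t) and u'' + i v'' = c^2 cosh(c t). *)
  set (u' := fun t => a * (sinh (a * t) * cos (b * t)) - b * (cosh (a * t) * sin (b * t))).
  set (v' := fun t => a * (cosh (a * t) * sin (b * t)) + b * (sinh (a * t) * cos (b * t))).
  set (u'' := fun t => (a ^ 2 - b ^ 2) * u t + (- (2 * a * b)) * v t).
  set (v'' := fun t => (2 * a * b) * u t + (a ^ 2 - b ^ 2) * v t).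
  assert (Cu := re_cosh_continuous (a, b) : forall t, continuous u t).
  assert (Cv := im_cosh_continuous (a, b) : forall t, continuous v t).
  assert (S0 : sinh 0 = 0) by (unfold sinh; rewrite Ropp_0; field).
  assert (Eu : cos_moment (S m) u'' + INR (S m) ^ 2 * cos_moment (S m) u
    = INR (S m) * INR m * cos_moment (pred m) u
      + match m with O => u (PI / 2) | S _ => 0 end).
  { apply cos_moment_parts with u'.
    - intros t. unfold u, u', re_cosh; simpl. auto_derive; [trivial | ring].
    - intros t. unfold u', u'', u, v, re_cosh, im_cosh; simpl. auto_derive; [trivial | ring].
    - intros t. apply (continuous_plus (V := R_NormedModule));
      apply (continuous_scal_r (V := R_NormedModule)); trivial.
    - unfold u'. rewrite !Rmult_0_r, sin_0, S0. ring. }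
  assert (Ev : cos_moment (S m) v'' + INR (S m) ^ 2 * cos_moment (S m) v
    = INR (S m) * INR m * cos_moment (pred m) v
      + match m with O => v (PI / 2) | S _ => 0 end).
  { apply cos_moment_parts with v'.
    - intros t. unfold v, v', im_cosh; simpl. auto_derive; [trivial | ring].
    - intros t. unfold v', v'', u, v, re_cosh, im_cosh; simpl. auto_derive; [trivial | ring].
    - intros t. apply (continuous_plus (V := R_NormedModule));
      apply (continuous_scal_r (V := R_NormedModule)); trivial.
    - unfold v'. rewrite !Rmult_0_r, sin_0, S0. ring. }
  rewrite (cos_moment_lin (S m) (a ^ 2 - b ^ 2) (- (2 * a * b)) u v u'') in Eu by auto.
  rewrite (cos_moment_lin (S m) (2 * a * b) (a ^ 2 - b ^ 2) u v v'') in Ev by auto.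
  set (x := cos_moment (S m) u) in *. set (y := cos_moment (S m) v) in *.
  set (x' := cos_moment (pred m) u) in *. set (y' := cos_moment (pred m) v) in *.
  rewrite <- RtoC_pow, <- RtoC_mult.
  set (n2 := INR (S m) ^ 2) in *. set (nm := INR (S m) * INR m) in *.
  apply injective_projections; destruct m; simpl; simpl in Eu, Ev; lra.
Qed.

(** * The normalized moments R_k and the finite factorization *)

Definition cosh_ratio (k : nat) (c : C) : C := (cosh_moment k c / wallis k)%C.

Lemma wallis_neq_0 (k : nat) : RtoC (wallis k) <> 0.
Proof. intros E. apply RtoC_inj in E. pose proof (wallis_pos k). lra. Qed.

Lemma INR_S_neq_0 (m : nat) : RtoC (INR (S m)) <> 0.
Proof. intros E. apply RtoC_inj in E. now apply not_0_INR in E. Qed.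

Lemma cosh_ratio_1 (c : C) :
  ((1 + c ^ 2) * cosh_ratio 1 c = Ccosh (c * (PI / 2)%R))%C.
Proof.
  assert (E := cosh_moment_rec 0 c). pose proof (wallis_rec 0) as W.
  simpl in E, W. unfold cosh_ratio.
  replace (wallis 1) with 1 by lra.
  transitivity ((1 * (1 * 1) + c * (c * 1)) * cosh_moment 1 c)%C; [simpl; field|].
  rewrite E. simpl; ring.
Qed.

(** Divide the recurrences of J and W at n = m + 2; the common factor n (n - 1) cancels. R_m is
    expressed through R_n and not conversely, because n^2 + c^2 may be zero. *)
Lemma cosh_ratio_rec (m : nat) (c : C) :
  cosh_ratio m c = ((1 + c ^ 2 / INR (S (S m)) ^ 2) * cosh_ratio (S (S m)) c)%C.
Proof.
  assert (E := cosh_moment_rec (S m) c). pose proof (wallis_rec (S m)) as W.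
  cbn [pred] in E, W. rewrite Rplus_0_r in W. rewrite Cplus_0_r in E.
  apply (f_equal RtoC) in W. rewrite !RtoC_mult, RtoC_pow in W.
  pose proof (wallis_neq_0 m) as H0. pose proof (wallis_neq_0 (S (S m))) as H2.
  pose proof (INR_S_neq_0 m) as N1. pose proof (INR_S_neq_0 (S m)) as N2.
  unfold cosh_ratio.
  set (p := RtoC (INR (S m))) in *. set (q := RtoC (INR (S (S m)))) in *.
  set (w := RtoC (wallis m)) in *. set (w2 := RtoC (wallis (S (S m)))) in *.
  assert (W' : w = (q * w2 / p)%C).
  { transitivity (q * p * w / (q * p))%C; [|rewrite <- W]. all: field; auto. }
  assert (E' : cosh_moment m c
    = ((q ^ 2 + c ^ 2) * cosh_moment (S (S m)) c / (q * p))%C).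
  { rewrite E. field; auto. }
  rewrite E', W'. field; auto.
Qed.

(** R_k - 1 is the moment of cosh(c t) - 1 divided by W_k. Real and imaginary parts each contribute
    at most K/(k + 2), hence the constant 2 K. *)
Lemma cosh_ratio_bound (c : C) :
  exists K, 0 <= K /\ forall k, Cmod (cosh_ratio k c - 1) <= K / (INR k + 2).
Proof.
  destruct (cosh_sub_1_bound c) as (K & HK & Hb).
  exists (2 * K). split; [lra|]. intros k.
  pose proof (wallis_pos k) as W. pose proof (pos_INR k).
  assert (Hc : forall t, continuous (fun t => re_cosh c t - 1) t).
  { intros t. apply (continuous_minus (V := R_NormedModule) (re_cosh c));
    [apply re_cosh_continuous | apply continuous_const]. }
  assert (Bu := cos_moment_bound k K _ Hc (fun t Ht => proj1 (Hb t Ht))).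
  assert (Bv := cos_moment_bound k K _ (im_cosh_continuous c) (fun t Ht => proj2 (Hb t Ht))).
  rewrite (cos_moment_lin k 1 (-1) (re_cosh c) (fun _ => 1)) in Bu;
    [|apply re_cosh_continuous | intros t; apply continuous_const | intros t; ring].
  fold (wallis k) in Bu.
  assert (E : (cosh_ratio k c - 1)%C
    = ((1 * cos_moment k (re_cosh c) + -1 * wallis k) / wallis k,
       cos_moment k (im_cosh c) / wallis k)).
  { unfold cosh_ratio, cosh_moment.
    apply injective_projections; simpl. all: field; lra. }
  rewrite E.
  assert (T : forall x y, Cmod (x, y) <= Rabs x + Rabs y).
  { intros x y. replace (x, y) with (x + Ci * y)%C
      by (apply injective_projections; simpl; ring).
    eapply Rle_trans; [apply Cmod_triangle|].
    rewrite Cmod_mult, !Cmod_R, Cmod_Ci. lra. }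
  eapply Rle_trans; [apply T|].
  assert (D : forall x, Rabs x <= K * (wallis k / (INR k + 2)) ->
                Rabs (x / wallis k) <= K / (INR k + 2)).
  { intros x Hx. unfold Rdiv. rewrite Rabs_mult, (Rabs_pos_eq (/ wallis k))
      by (left; now apply Rinv_0_lt_compat).
    apply Rmult_le_reg_r with (wallis k); [exact W|].
    replace (Rabs x * / wallis k * wallis k) with (Rabs x) by (field; lra).
    eapply Rle_trans; [exact Hx|]. right; field; lra. }
  apply D in Bu. apply D in Bv. lra.
Qed.

(** Factors 1 to n + 1 belong to the odd numbers 1, 3, ..., 2n + 1, so the remainder is R_(2n+1).
    The induction starts from [cosh_ratio_1] and unfolds R by two indices at a time. *)
Lemma Ccosh_partial_product (n : nat) (c : C) :
  (Ccosh (c * (PI / 2)%R)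
   = Cprod_upto (fun k => 1 + c ^ 2 / (2 * INR k - 1) ^ 2) (S n)
     * cosh_ratio (S (2 * n)) c)%C.
Proof.
  induction n as [|n IH].
  - simpl Cprod_upto. change (S (2 * 0)) with 1%nat. rewrite <- cosh_ratio_1. simpl INR.
    rewrite Cmult_1_l. f_equal. field.
  - rewrite IH, (cosh_ratio_rec (S (2 * n))).
    replace (S (2 * S n)) with (S (S (S (2 * n)))) by lia.
    replace (RtoC (INR (S (S (S (2 * n)))))) with (2 * INR (S (S n)) - 1)%C.
    - cbn [Cprod_upto]. ring.
    - rewrite !S_INR, mult_INR. apply injective_projections; simpl; ring.
Qed.

(** As cosh x > 0, the real part forces cos y = 0; then sin y is nonzero and the imaginary part
    forces sinh x = 0, so x = 0. *)
Lemma Ccosh_eq_0 (z : C) :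
  Ccosh z = 0 -> exists k : Z, z = (Ci * (2 * IZR k - 1) * PI / 2)%C.
Proof.
  rewrite Ccosh_parts. destruct z as [x y]; simpl Re; simpl Im. intros E.
  assert (E1 := f_equal fst E). assert (E2 := f_equal snd E). simpl in E1, E2.
  pose proof (exp_pos x) as P. pose proof (exp_pos (- x)) as P'.
  apply Rmult_integral in E1.
  destruct E1 as [E1|E1]; [unfold cosh in E1; lra|].
  apply Rmult_integral in E2. destruct E2 as [E2|E2].
  - assert (x = 0).
    { assert (exp x = exp (- x)) as H by (unfold sinh in E2; lra).
      apply exp_inv in H. lra. }
    (* The library gives y = k pi + pi/2, which is (2 (k + 1) - 1) pi/2. *)
    destruct (cos_eq_0_0 y E1) as [k Hk]. exists (k + 1)%Z.
    rewrite plus_IZR. apply injective_projections; simpl; [lra|].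
    rewrite Hk. field.
  - pose proof (sin2_cos2 y) as H. rewrite E1, E2 in H. unfold Rsqr in H. lra.
Qed.

(** * Limits of sequences determined by a quotient *)

Lemma filterlim_C_eps (p : nat -> C) (P : C) :
  (forall eps, 0 < eps -> exists N, forall n, (N <= n)%nat -> Cmod (p n - P) < eps) ->
  filterlim p eventually (locally P).
Proof.
  intros H. apply (proj2 (filterlim_locally (U := C_UniformSpace) p P)).
  intros eps. destruct (H eps (cond_pos eps)) as [N HN].
  (* A [Cmod] disc lies in the ball of the same radius of the uniform structure on [C]. *)
  exists N. intros n Hn. now apply C_NormedModule_mixin_compat1, HN.
Qed.

(** In effect p(n + 1) = P q_n / r_n with q and r tending to 1. The relation is stated without
    division because early r_n may vanish. The estimate rests on (p(n + 1) - P) r_n = P ((q_n - 1) -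
    (r_n - 1)). *)
Lemma filterlim_ratio (p q r : nat -> C) (P : C) (Kq Kr : R) :
  0 <= Kq -> 0 <= Kr ->
  (forall n, Cmod (q n - 1) <= Kq / (INR n + 1)) ->
  (forall n, Cmod (r n - 1) <= Kr / (INR n + 1)) ->
  (forall n, (p (S n) * r n = P * q n)%C) ->
  filterlim p eventually (locally P).
Proof.
  intros HKq HKr Hq Hr Hp. apply filterlim_C_eps. intros eps He.
  pose proof (Cmod_ge_0 P) as HP.
  (* Beyond the first summand |r_n| >= 1/2; beyond the second |P| (Kq + Kr) / (n + 1) < eps/2, and
     dividing by |r_n| at most doubles this. *)
  set (X := 2 * Kr + 2 * Cmod P * (Kq + Kr) / eps).
  assert (HX : 2 * Cmod P * (Kq + Kr) / eps * eps = 2 * Cmod P * (Kq + Kr)) by (field; lra).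
  assert (HX0 : 0 <= 2 * Cmod P * (Kq + Kr) / eps).
  { apply Rmult_le_pos; [|left; now apply Rinv_0_lt_compat].
    apply Rmult_le_pos; lra. }
  destruct (INR_unbounded X) as [N HN]. exists (S N). intros [|n] Hn; [lia|].
  assert (Hn' : X < INR n + 1).
  { apply le_S_n, le_INR in Hn. lra. }
  unfold X in Hn'. specialize (Hq n). specialize (Hr n). specialize (Hp n).
  set (d := INR n + 1) in *.
  assert (Hd : 0 < d) by (unfold d; pose proof (pos_INR n); lra).
  assert (R1 : Kr / d <= / 2).
  { apply Rmult_le_reg_r with d; [exact Hd|]. unfold Rdiv.
    rewrite Rmult_assoc, Rinv_l by lra. lra. }
  assert (R2 : / 2 <= Cmod (r n)).
  { pose proof (Cmod_triangle (r n) (1 - r n)%C) as T.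
    replace (r n + (1 - r n))%C with (RtoC 1) in T by ring.
    rewrite Cmod_1 in T.
    replace (1 - r n)%C with (- (r n - 1))%C in T by ring.
    rewrite Cmod_opp in T. lra. }
  assert (E : ((p (S n) - P) * r n = P * ((q n - 1) + - (r n - 1)))%C).
  { transitivity (p (S n) * r n - P * r n)%C; [ring|]. rewrite Hp. ring. }
  apply (f_equal Cmod) in E. rewrite !Cmod_mult in E.
  assert (T : Cmod ((q n - 1) + - (r n - 1)) <= (Kq + Kr) / d).
  { eapply Rle_trans; [apply Cmod_triangle|]. rewrite Cmod_opp. unfold Rdiv in *. lra. }
  assert (B : Cmod P * ((Kq + Kr) / d) < eps / 2).
  { apply Rmult_lt_reg_r with d; [exact Hd|].
    replace (Cmod P * ((Kq + Kr) / d) * d) with (Cmod P * (Kq + Kr)) by (field; lra).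
    assert (2 * Cmod P * (Kq + Kr) / eps < d) by lra.
    nra. }
  pose proof (Cmod_ge_0 (p (S n) - P)).
  assert (Cmod P * Cmod (q n - 1 + - (r n - 1)) <= Cmod P * ((Kq + Kr) / d))
    by now apply Rmult_le_compat_l.
  nra.
Qed.

(** * Finite products and the quotient of two factorizations *)

Lemma Cprod_upto_mult (a b c : nat -> C) (n : nat) :
  (forall k, (1 <= k <= n)%nat -> c k = (a k * b k)%C) ->
  Cprod_upto c n = (Cprod_upto a n * Cprod_upto b n)%C.
Proof.
  induction n as [|n IH]; intros H; simpl; [ring|].
  rewrite IH by (intros k Hk; apply H; lia). rewrite (H (S n)) by lia. ring.
Qed.

Lemma Cprod_upto_neq_0 (a : nat -> C) (n k : nat) :
  (1 <= k <= n)%nat -> Cprod_upto a n <> 0 -> a k <> 0.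
Proof.
  induction n as [|n IH]; intros Hk H E; [lia|]. simpl in H.
  destruct (Nat.eq_dec k (S n)) as [->|]; [apply H; rewrite E; ring|].
  apply IH; [lia | | exact E]. intros E'. apply H. rewrite E'. ring.
Qed.

Theorem corollary7 (l : R) (beta : C)
  (hl : l <> 0%R)
  (hbeta : forall k : Z,
     beta <> (l + Ci * (2 * IZR k - 1) * PI / 2)%C)
  (s : C) :
  exists P : C,
    is_infprod
      (fun k : nat =>
         1 + ((s - l) ^ 2 - (beta - l) ^ 2)
             / ((2 * INR k - 1) ^ 2 * PI ^ 2 / 4 + (beta - l) ^ 2))%C P
    /\ (Ccosh (s - l) = Ccosh (beta - l) * P)%C.
Proof.
  set (W := (s - l)%C). set (B := (beta - l)%C).
  (* Every zero of cosh(beta - l) is one of the excluded values of beta. *)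
  assert (HB : Ccosh B <> 0).
  { intros E. destruct (Ccosh_eq_0 B E) as [k Hk]. apply (hbeta k).
    unfold B in Hk. rewrite <- Hk. ring. }
  assert (HPI : RtoC PI <> 0).
  { intros E. apply RtoC_inj in E. now apply PI_neq0. }
  set (w := (2 * W / PI)%C). set (b := (2 * B / PI)%C).
  assert (Hhalf : forall z : C, (2 * z / PI * (PI / 2)%R = z)%C).
  { intros z. rewrite RtoC_div by lra. field. exact HPI. }
  pose proof (fun n => Ccosh_partial_product n w) as Fw.
  pose proof (fun n => Ccosh_partial_product n b) as Fb.
  unfold w at 1 in Fw. unfold b at 1 in Fb. rewrite Hhalf in Fw, Fb.
  set (fw := fun k => (1 + w ^ 2 / (2 * INR k - 1) ^ 2)%C) in Fw.
  set (fb := fun k => (1 + b ^ 2 / (2 * INR k - 1) ^ 2)%C) in Fb.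
  exists (Ccosh W / Ccosh B)%C. split; [|field; exact HB].
  set (a := fun k : nat =>
    (1 + (W ^ 2 - B ^ 2) / ((2 * INR k - 1) ^ 2 * PI ^ 2 / 4 + B ^ 2))%C).
  destruct (cosh_ratio_bound w) as (Kw & Kw0 & HKw).
  destruct (cosh_ratio_bound b) as (Kb & Kb0 & HKb).
  (* These partial products divide cosh B, which is nonzero; so no factor of [fb] vanishes, and
     hence no denominator in [a]. *)
  assert (Hb : forall n, Cprod_upto fb (S n) <> 0).
  { intros n E. apply HB. rewrite (Fb n), E. ring. }
  (* With j = 2k - 1, multiplying by j^2 pi^2 / 4 turns 1 + w^2/j^2 and 1 + b^2/j^2 into j^2 pi^2 /
     4 + W^2 and j^2 pi^2 / 4 + B^2, whose quotient is [a k]. *)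
  assert (Hfac : forall n,
    Cprod_upto fw (S n) = (Cprod_upto a (S n) * Cprod_upto fb (S n))%C).
  { intros n. apply Cprod_upto_mult. intros k Hk.
    pose proof (Cprod_upto_neq_0 fb (S n) k Hk (Hb n)) as H.
    assert (Hj : (2 * INR k - 1)%C <> 0).
    { rewrite <- RtoC_mult, <- RtoC_minus. intros E. apply RtoC_inj in E.
      assert (1 <= INR k)%R by (apply (le_INR 1); lia). lra. }
    unfold fw, a, fb, w, b in *.
    assert (D : ((2 * INR k - 1) ^ 2 * PI ^ 2 / 4 + B ^ 2)%C <> 0).
    { intros E. apply H.
      transitivity (((2 * INR k - 1) ^ 2 * PI ^ 2 / 4 + B ^ 2)
                    * (4 / ((2 * INR k - 1) ^ 2 * PI ^ 2)))%C;
        [field; auto | rewrite E; ring]. }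
    set (j := (2 * INR k - 1)%C) in *.
    (* The denominator multiplied by 4, in the shape of the side condition of [field]. *)
    assert (D' : ((j * PI) ^ 2 + B ^ 2 * 4)%C <> 0).
    { intros E. apply D. transitivity (((j * PI) ^ 2 + B ^ 2 * 4) / 4)%C;
        [field | rewrite E; field]. }
    field. repeat split; [exact HPI | exact Hj | exact D']. }
  assert (Hle : forall K n, 0 <= K -> K / (INR (S (2 * n)) + 2) <= K / (INR n + 1)).
  { intros K n HK. unfold Rdiv. apply Rmult_le_compat_l; [exact HK|].
    pose proof (pos_INR n). apply Rinv_le_contravar; [lra|].
    rewrite S_INR, mult_INR; simpl; lra. }
  (* Since cosh W is the product of [a] times that of [fb] times R(w), and cosh B is the product of
     [fb] times R(b), the product of [a] times R(w) equals (cosh W / cosh B) R(b). *)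
  apply (filterlim_ratio _ (fun n => cosh_ratio (S (2 * n)) b)
           (fun n => cosh_ratio (S (2 * n)) w) _ Kb Kw Kb0 Kw0).
  { intros n. exact (Rle_trans _ _ _ (HKb _) (Hle Kb n Kb0)). }
  { intros n. exact (Rle_trans _ _ _ (HKw _) (Hle Kw n Kw0)). }
  intros n.
  transitivity (Cprod_upto a (S n) * cosh_ratio (S (2 * n)) w * Ccosh B / Ccosh B)%C;
    [field; exact HB|].
  rewrite (Fw n), Hfac. rewrite (Fb n) at 1. field. exact HB.
Qed.
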